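(* Let $P(z) \in \mathbb{C}[z, z^{-1}]$ be a non-zero Laurent polynomial, possibly with repeated roots, and let $z_1,\dots,z_n$ be the distinct roots of $P$. For each positive integer $k$ let \[ m_k(P) = \int_0^1 \log^k \left| P\left(e^{2\pi i t}\right)\right| \, dt. \] Then \[ \lim_{k\to\infty} \frac{|m_k(P)|}{k!} = \frac{1}{\pi} \sum_{z_j \in S^1} \frac{1}{|P'(z_j)|}, \] where $S^1=\{z\in\mathbb{C}: |z|=1\}$, $P'$ is the derivative of $P$ with respect to $z$, the sum is over those distinct roots $z_j$ lying on $S^1$ (an empty sum being $0$), and the right-hand side is interpreted as $\infty$ if $P'(z_j)=0$ for some root $z_j \in S^1$ (i.e., if $P$ has a repeated root on $S^1$), in which case the limit on the left is $+\infty$.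
   Context: $m_k(P)$ is called the $k$-higher Mahler measure of $P$; $\log^k x$ means $(\log x)^k$. *)

(* Defs.v *)
From HB Require Import structures.
From mathcomp Require Import all_boot all_order all_algebra.
From mathcomp Require Import all_classical all_reals all_analysis.
From mathcomp Require Import complex.
Import Order.TTheory GRing.Theory Num.Theory.
Local Open Scope ring_scope.
Local Open Scope complex_scope.

Set Implicit Arguments.
Unset Strict Implicit.
Unset Printing Implicit Defensive.

Definition cmod {R : realType} (z : R[i]) : R :=
  Num.sqrt (complex.Re z ^+ 2 + complex.Im z ^+ 2).

Definition expi2pi {R : realType} (t : R) : R[i] :=
  (cos (2 * pi * t)) +i* (sin (2 * pi * t)).

(* A Laurent polynomial P(z) = z^{-d} Q(z), with d : nat and Q : {poly C}.
   Every element of C[z, z^{-1}] has this form. *)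
Record laurent (R : realType) := Laurent { ldeg : nat ; lpoly : {poly R[i]} }.

(* evaluation P(z) = Q(z) / z^d (meaningful for z <> 0) *)
Definition leval {R : realType} (P : laurent R) (z : R[i]) : R[i] :=
  (lpoly P).[z] / z ^+ ldeg P.

Definition lderiv {R : realType} (P : laurent R) (z : R[i]) : R[i] :=
  (lpoly P)^`().[z] / z ^+ ldeg P
  - (ldeg P)%:R * (lpoly P).[z] / z ^+ (ldeg P).+1.

Definition lnonzero {R : realType} (P : laurent R) : Prop := lpoly P != 0.

Definition lroot {R : realType} (P : laurent R) (z : R[i]) : bool :=
  (z != 0) && (leval P z == 0).

Definition higher_mahler {R : realType} (k : nat) (P : laurent R) : \bar R :=
  (\int[lebesgue_measure]_(t in `[0%R, 1%R]%classic)
     ((ln (cmod (leval P (expi2pi t)))) ^+ k)%:E)%E.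

(* right-hand side: (1/pi) sum_{z_j in s} 1/|P'(z_j)|, or +oo if some
   P'(z_j) = 0; s is meant to list the distinct roots on S^1 *)
Definition mahler_rhs {R : realType} (P : laurent R) (s : seq R[i]) : \bar R :=
  if has (fun z => lderiv P z == 0) s then +oo%E
  else ((pi^-1) * \sum_(z <- s) (cmod (lderiv P z))^-1)%:E.

(* Main.v *)
(** The singular part of [ln |P(e(t))|], with [e(t) = exp(2 i pi t)], lives at the
zeros of [t |-> |P(e(t))|], and there it has the sign of [(-1)^k].  Put
[L := max(0, - ln |P(e(t))|)].  The positive part of [ln |P(e(t))|] is bounded
by some [M] and contributes at most [M^k / k! --> 0] to [|m_k(P)| / k!], so it
suffices to study the integral of [L^k / k!].  Away from the zeros [L] is
bounded.  At a zero [x] one has [|P(e(t))| = |t - x| h(t)] with [h] continuous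
at [x] and [h(x) = 2 pi |P'(e(x))|]; comparing [h] with constants reduces each
side of [x] to the model [L = - ln (c (t - x))], where a primitive of [L^k / k!]
is [(t - x) (1 + L + ... + L^k / k!)].  At the far end [t = b] this tends to
[(b - x) exp L = 1 / c].  Hence each of the two sides of [x] contributes
[1 / h(x)], which is infinite exactly when the root is repeated. *)
Require Import Defs.
From HB Require Import structures.
From mathcomp Require Import all_boot all_order all_algebra.
From mathcomp Require Import all_classical all_reals all_analysis.
From mathcomp Require Import complex.
From mathcomp Require Import measurable_realfun ring lra.
Import Order.TTheory GRing.Theory Num.Theory numFieldNormedType.Exports.
Local Open Scope ring_scope.
Local Open Scope classical_set_scope.

Set Implicit Arguments.
Unset Strict Implicit.

(** * The logarithmic model *)

Section log_model.
Context {R : realType}.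
Local Notation mu := (@lebesgue_measure R).

(** [series u n] sums the first [n] terms, so [k.+1] truncates the exponential series after degree
    [k]. *)
Definition log_primitive (c a : R) (k : nat) (t : R) : R :=
  (t - a) * series (exp_coeff (- ln (c * (t - a)))) k.+1.

Lemma is_derive_ln_affine (c a t : R) : 0 < c -> a < t ->
  is_derive t 1 (fun x : R => - ln (c * (x - a))) (- (t - a)^-1).
Proof.
move=> c0 at0; have ta : 0 < t - a by rewrite subr_gt0.
have d1 : is_derive (c * (t - a)) 1 (@ln R) (c * (t - a))^-1.
  by apply: is_derive1_ln; rewrite mulr_gt0.
have d2 : is_derive t 1 (fun x : R => c * (x - a)) c.
  by apply: is_derive_eq; rewrite /GRing.scale/= !(subr0, mulr1, mulr0, addr0, add0r).
apply: (is_derive_eq (is_deriveN (is_derive1_comp (g := fun x => c * (x - a)) d1 d2))).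
by congr (- _); field; rewrite !gt_eqF.
Qed.

Lemma is_derive_exp_coeff_ln (c a t : R) (k : nat) : 0 < c -> a < t ->
  is_derive t 1 (fun x : R => exp_coeff (- ln (c * (x - a))) k.+1)
    (- (exp_coeff (- ln (c * (t - a))) k / (t - a))).
Proof.
move=> c0 at0; have ta : 0 < t - a by rewrite subr_gt0.
rewrite (_ : (fun x => _) = (k.+1`!%:R^-1 \*:
    (fun x : R => - ln (c * (x - a))) ^+ k.+1)); last first.
  by apply/funext => x; rewrite /exp_coeff/= exprfctE mulrC.
have dL := is_derive_ln_affine c0 at0.
apply: (is_derive_eq (is_deriveZ k.+1`!%:R^-1 (is_deriveX k.+1 dL))).
rewrite /GRing.scale/= /exp_coeff/= factS natrM invfM.
have kf : k`!%:R != 0 :> R by rewrite pnatr_eq0 -lt0n fact_gt0.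
have k1 : k.+1%:R != 0 :> R by rewrite pnatr_eq0.
move: k.+1%:R k`!%:R k1 kf => x y k1 kf.
by field; rewrite kf k1 (gt_eqF ta).
Qed.

(** Telescoping: with [L := - ln (c * (t - a))], the term [(t - a) * L^(k+1) / (k+1)!] has
    derivative [L^(k+1) / (k+1)! - L^k / k!], and the second part cancels the derivative from the
    previous step. *)
Lemma is_derive_log_primitive (c a : R) (k : nat) (t : R) : 0 < c -> a < t ->
  is_derive t 1 (log_primitive c a k) (exp_coeff (- ln (c * (t - a))) k).
Proof.
move=> c0 at0; have ta : 0 < t - a by rewrite subr_gt0.
elim: k => [|k IH].
  rewrite (_ : log_primitive _ _ _ = fun x => x - a); last first.
    apply/funext => x; rewrite /log_primitive seriesEnat/= big_nat1.
    by rewrite /exp_coeff/= expr0 fact0 invr1 !mulr1.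
  by apply: is_derive_eq; rewrite /exp_coeff/= expr0 fact0 invr1 mulr1 oppr0 addr0.
rewrite (_ : log_primitive _ _ _ = fun x => log_primitive c a k x +
   (x - a) * exp_coeff (- ln (c * (x - a))) k.+1); last first.
  by apply/funext => x; rewrite /log_primitive !seriesEnat/= big_nat_recr//= mulrDr.
have dp := is_derive_exp_coeff_ln k c0 at0.
apply: (is_derive_eq (is_deriveD IH
  (is_deriveM (is_deriveB (is_derive_id t 1) (is_derive_cst a t 1)) dp))).
rewrite /GRing.scale/= !fctE subr0; field.
by rewrite gt_eqF.
Qed.

(** The single term of degree [i + 1] of the exponential series already lies below [exp L]. This
    gives the decay of the primitive at the singular endpoint. *)
Lemma exp_coeff_inv_bound (L : R) (i : nat) : 0 < L ->
  expR (- L) * exp_coeff L i <= i.+1%:R / L.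
Proof.
move=> L0; rewrite expRN ler_pdivlMr// mulrAC -mulrA ler_pdivrMl ?expR_gt0//.
have := expR_ge1Dxn i (ltW L0).
move=> h; have {}h : L ^+ i.+1 / i.+1`!%:R <= expR L by lra.
rewrite mulrC -ler_pdivrMr ?ltr0n//; apply: le_trans h.
rewrite /exp_coeff/= factS natrM invfM exprSr le_eqVlt; apply/orP; left; apply/eqP.
by ring.
Qed.

Lemma continuous_log_primitive (c a : R) (k : nat) (t : R) : 0 < c -> a < t ->
  {for t, continuous (log_primitive c a k)}.
Proof.
move=> c0 ta; apply: differentiable_continuous; apply/derivable1_diffP.
by have [] := is_derive_log_primitive k c0 ta.
Qed.

Lemma measurable_exp_coeff_ln (c a : R) (k : nat) (D : set R) :
  measurable_fun D (fun t : R => exp_coeff (- ln (c * (t - a))) k).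
Proof.
apply: measurable_funTS; rewrite /exp_coeff/=.
apply: measurable_funM => //; apply: measurable_funX.
apply: measurable_funN; apply: (measurableT_comp (@measurable_ln R)).
by apply: measurable_funM => //; exact: measurable_funB.
Qed.

Lemma integral_log_model_sub (c a x b : R) (k : nat) : 0 < c -> a < x -> x < b ->
  (\int[mu]_(t in `[x, b]) (exp_coeff (- ln (c * (t - a))) k)%:E
   = (log_primitive c a k b - log_primitive c a k x)%:E)%E.
Proof.
move=> c0 ax xb; rewrite EFinB; apply: continuous_FTC2 => //.
- apply: derivable_within_continuous => t; rewrite in_itv/= => /andP[xt _].
  case: k => [|k]; last first.
    by have [] := is_derive_exp_coeff_ln k c0 (lt_le_trans ax xt).
  rewrite (_ : (fun x => _) = cst 1); first exact: derivable_cst.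
  by apply/funext => y; rewrite /exp_coeff/= expr0 fact0 invr1 mulr1.
- split.
  + by move=> t; rewrite in_itv/= => /andP[xt _];
      have [] := is_derive_log_primitive k c0 (lt_trans ax xt).
  + apply: cvg_at_right_filter; exact: continuous_log_primitive.
  + apply: cvg_at_left_filter; apply: continuous_log_primitive => //.
    exact: lt_trans xb.
- move=> t; rewrite in_itv/= => /andP[xt _].
  have [_] := is_derive_log_primitive k c0 (lt_trans ax xt).
  by rewrite derive1E.
Qed.

(* [exp (- L) L^i / i! <= (i + 1) / L], where [L >= n + 1] along the sequence. *)
Lemma log_primitive_cvg0 (c a b : R) (k : nat) :
  0 < c -> a < b -> c * (b - a) <= 1 ->
  log_primitive c a k (a + (b - a) * expR (- n.+1%:R)) @[n --> \oo] --> 0.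
Proof.
move=> c0 ab cab; have ba : 0 < b - a by rewrite subr_gt0.
apply: (@squeeze_cvgr _ _ _ _ (cst 0) (fun n => (c^-1 * (\sum_(0 <= i < k.+1) i.+1%:R)) * n.+1%:R^-1)).
- apply: nearW => n; rewrite /log_primitive addrAC subrr add0r mulrA.
  have h0 : 0 < c * (b - a) * expR (- n.+1%:R) by rewrite !mulr_gt0// expR_gt0.
  have Lge : n.+1%:R <= - ln (c * (b - a) * expR (- n.+1%:R)).
    rewrite lerNr -[leRHS]expRK ler_ln ?posrE ?expR_gt0//.
    by rewrite ler_piMl// expR_ge0.
  set L := - ln _ in Lge *.
  have L0 : 0 < L by apply: lt_le_trans Lge; rewrite ltr0n.
  (* The distance to [a] is itself [exp (- L) / c], which supplies the factor [exp (- L)] that beats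
     each power of [L]. *)
  have -> : (b - a) * expR (- n.+1%:R) = c^-1 * expR (- L).
    by rewrite /L opprK lnK ?posrE// -mulrA mulKf// gt_eqF.
  rewrite seriesEnat/= !mulr_ge0 ?invr_ge0 ?(ltW c0) ?expR_ge0//=; last first.
    by apply: sumr_ge0 => i _; apply: exp_coeff_ge0; exact: ltW.
  rewrite -!mulrA ler_wpM2l ?invr_ge0 ?(ltW c0)//.
  rewrite mulr_suml mulr_sumr; apply: ler_sum => i _.
  apply: (le_trans (exp_coeff_inv_bound i L0)).
  by rewrite ler_wpM2l// lef_pV2// posrE.
- exact: cvg_cst.
- rewrite -[X in _ --> X](mulr0 (c^-1 * (\sum_(0 <= i < k.+1) i.+1%:R))).
  by apply: cvgMr; exact: cvg_harmonic.
Qed.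

(** The bound [c * (b - a) <= 1] makes the integrand nonnegative, so monotone convergence applies
    along intervals [[a + h n, b]] exhausting []a, b]]. On each of them the integral is a difference
    of primitives, whose lower end tends to 0. *)
Lemma integral_log_model (c a b : R) (k : nat) :
  0 < c -> a < b -> c * (b - a) <= 1 ->
  (\int[mu]_(t in `]a, b]) (exp_coeff (- ln (c * (t - a))) k)%:E
   = (log_primitive c a k b)%:E)%E.
Proof.
move=> c0 ab cab; have ba : 0 < b - a by rewrite subr_gt0.
pose h (n : nat) : R := (b - a) * expR (- n.+1%:R).
have h0 n : 0 < h n by rewrite mulr_gt0// expR_gt0.
have hlt n : h n < b - a.
  by rewrite gtr_pMr// expR_lt1 oppr_lt0 ltr0n.
have UE : \bigcup_n `[a + h n, b]%classic = `]a, b]%classic.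
  apply/seteqP; split => [t [n _]|t]/=; rewrite !in_itv/=.
    by move=> /andP[+ ->]; rewrite andbT; apply: lt_le_trans; rewrite ltrDl.
  move=> /andP[at0 tb].
  have hcvg : h n @[n --> \oo] --> 0.
    rewrite -[X in _ --> X](mulr0 (b - a)); apply: cvgMr.
    by have := @cvgn_expR R; rewrite -cvg_shiftS.
  have ta : 0 < t - a by rewrite subr_gt0.
  have [n _ /(_ n (leqnn n))] := cvgr_lt _ hcvg _ ta.
  move=> /= hn; exists n => //=; rewrite in_itv/= tb andbT; lra.
pose u n := (\int[mu]_(t in `[(a + h n)%R, b]) (exp_coeff (- ln (c * (t - a))) k)%:E)%E.
suff [ui up] : u @ \oo --> (\int[mu]_(t in `]a, b]) (exp_coeff (- ln (c * (t - a))) k)%:E)%E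
    /\ u @ \oo --> (log_primitive c a k b)%:E.
  exact: (cvg_unique _ ui up).
split.
  rewrite -UE; apply: ge0_nondecreasing_set_cvg_integral => //.
  - move=> m n mn; rewrite subsetEset => t/=; rewrite !in_itv/= => /andP[+ ->].
    rewrite andbT; apply: le_trans; rewrite lerD2l ler_wpM2l ?(ltW ba)//.
    by rewrite ler_expR lerN2 ler_nat.
  - by move=> n; apply/measurable_EFinP; exact: measurable_exp_coeff_ln.
  - move=> n t/=; rewrite in_itv/= => /andP[ht tb]; rewrite lee_fin.
    apply: exp_coeff_ge0; rewrite oppr_ge0 ln_le0//.
    apply: le_trans cab; rewrite ler_wpM2l ?(ltW c0)//; lra.
rewrite (_ : u = (fun n => (log_primitive c a k b -
   log_primitive c a k (a + h n))%:E)); last first.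
  apply/funext => n; rewrite /u integral_log_model_sub// ?ltrDl//.
  by have := hlt n; lra.
apply: cvg_EFin; first exact: nearW.
rewrite -[X in _ --> X]subr0; apply: cvgB; first exact: cvg_cst.
exact: log_primitive_cvg0.
Qed.

(** The full series sums to [1 / (c * (b - a))]. The limit does not depend on [b]: only the
    behaviour near [a] counts. *)
Lemma log_primitive_cvg (c a b : R) : 0 < c -> a < b ->
  log_primitive c a k b @[k --> \oo] --> c^-1.
Proof.
move=> c0 ab; have ba : 0 < b - a by rewrite subr_gt0.
have -> : c^-1 = (b - a) * expR (- ln (c * (b - a))).
  rewrite expRN lnK ?posrE ?mulr_gt0// invfM; field; lra.
apply: cvgMr.
have := @is_cvg_series_exp_coeff R (- ln (c * (b - a))).
by rewrite -(cvg_shiftS).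
Qed.

End log_model.

(** * Means of powers of the negative part of a logarithm *)

Section neglog_mean.
Context {R : realType}.
Local Notation mu := (@lebesgue_measure R).

(* Since [ln 0 = 0], [neglog g] vanishes at the zeros of [g]: a null set. *)
Definition neglog (g : R -> R) (t : R) : R := Num.max 0 (- ln (g t)).

(** The normalisation is by [k!], contained in [exp_coeff x k = x^k / k!], and not by the length
    [b - a]; this makes it additive in the interval. *)
Definition neglog_mean (g : R -> R) (k : nat) (a b : R) : \bar R :=
  (\int[mu]_(t in `[a, b]) (exp_coeff (neglog g t) k)%:E)%E.

Lemma neglog_ge0 (g : R -> R) (t : R) : 0 <= neglog g t.
Proof. by rewrite le_max lexx. Qed.

Lemma exp_coeff_neglog_ge0 (g : R -> R) (k : nat) (t : R) :
  0 <= exp_coeff (neglog g t) k.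
Proof. exact/exp_coeff_ge0/neglog_ge0. Qed.

Lemma ler_exp_coeff (x y : R) (k : nat) : 0 <= x -> x <= y ->
  exp_coeff x k <= exp_coeff y k.
Proof.
move=> x0 xy; rewrite /exp_coeff/= ler_wpM2r ?invr_ge0//.
by apply: lerXn2r => //; rewrite nnegrE//; exact: le_trans xy.
Qed.

Lemma neglog_mean_ge0 (g : R -> R) (k : nat) (a b : R) :
  (0 <= neglog_mean g k a b)%E.
Proof. by apply: integral_ge0 => t _; rewrite lee_fin exp_coeff_neglog_ge0. Qed.

Lemma measurable_exp_coeff_neglog (g : R -> R) (k : nat) (D : set R) :
  measurable_fun setT g -> measurable_fun D (fun t => exp_coeff (neglog g t) k).
Proof.
move=> mg; apply: measurable_funTS; rewrite /exp_coeff/=.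
apply: measurable_funM => //; apply: measurable_funX.
apply: measurable_maxr => //; apply: measurable_funN.
exact: (measurableT_comp (@measurable_ln R)).
Qed.

Lemma neglog_mean_cat (g : R -> R) (k : nat) (a b c : R) :
  measurable_fun setT g -> a <= b -> b <= c ->
  neglog_mean g k a c = (neglog_mean g k a b + neglog_mean g k b c)%E.
Proof.
move=> mg ab bc; rewrite /neglog_mean.
have mE D : measurable_fun D (fun t => (exp_coeff (neglog g t) k)%:E).
  by apply/measurable_EFinP; exact: measurable_exp_coeff_neglog.
rewrite -[X in (_ = _ + X)%E]integral_itv_obnd_cbnd// -ge0_integral_setU//.
- by rewrite -itv_bndbnd_setU.
- exact: mE.
- by move=> t _; rewrite lee_fin exp_coeff_neglog_ge0.
- apply/disj_setPS => t [] /=; rewrite !in_itv/= => /andP[_ tb] /andP[bt _].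
  by move: (le_lt_trans tb bt); rewrite ltxx.
Qed.

(** Lebesgue measure is invariant under [t |-> - t]; this carries results on the right of a zero
    over to its left. *)
Lemma neglog_mean_opp (g : R -> R) (k : nat) (a b : R) :
  measurable_fun setT g ->
  neglog_mean (g \o -%R) k (- b) (- a) = neglog_mean g k a b.
Proof.
move=> mg; rewrite /neglog_mean.
transitivity (\int[pushforward mu (-%R : _ -> measurableTypeR R)]_(t in `[a, b])
    (exp_coeff (neglog g t) k)%:E)%E; last first.
  by apply: eq_measure_integral => //= A mA AS; exact: lebesgue_measureN.
rewrite ge0_integral_pushforward//=.
- by rewrite opp_preimage_itvbndbnd.
- by apply/measurable_EFinP; exact: measurable_exp_coeff_neglog.
- by move=> t _; rewrite lee_fin exp_coeff_neglog_ge0.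
Qed.

(** By compactness [g] has a positive minimum on [[a, b]], so [neglog g] is bounded by a constant
    [N], and [N^k / k!] tends to 0. *)
Lemma neglog_mean_pos_cvg0 (g : R -> R) (a b : R) :
  continuous g -> a <= b -> (forall t, a <= t <= b -> 0 < g t) ->
  neglog_mean g k a b @[k --> \oo] --> 0%E.
Proof.
move=> cg ab g0.
have [m mab gm] := EVT_min ab (continuous_subspaceT cg).
rewrite in_itv/= in mab.
have gm0 := g0 _ mab.
have mg : measurable_fun setT g by exact: continuous_measurable_fun.
apply: (@squeeze_cvge _ _ _ _ (cst 0%E) _
  (fun k => (exp_coeff (neglog g m) k * (b - a))%:E)).
- apply: nearW => k; rewrite neglog_mean_ge0/=.
  rewrite [leRHS](_ : _ = \int[mu]_(t in `[a, b]) (exp_coeff (neglog g m) k)%:E)%E; last first.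
    rewrite integral_cst//= lebesgue_measure_itv/= lte_fin.
    have [ltab|] := ltP a b; first by rewrite EFinM EFinB.
    move=> ba; have -> : a = b by apply/eqP; rewrite eq_le ab.
    by rewrite subrr mulr0 mule0.
  apply: ge0_le_integral => //.
  + by move=> t _; rewrite lee_fin exp_coeff_neglog_ge0.
  + by apply/measurable_EFinP; exact: measurable_exp_coeff_neglog.
  + move=> t /= tab; rewrite lee_fin ler_exp_coeff ?neglog_ge0//.
    have gt0 := g0 t; rewrite in_itv/= in tab.
    rewrite /neglog ge_max le_max lexx/= le_max lerN2 ler_ln ?posrE ?gt0//.
    by rewrite gm ?orbT// in_itv.
- exact: cvg_cst.
- rewrite -[X in _ --> X]/((0 : R)%:E); apply: cvg_EFin; first exact: nearW.
  rewrite -(mul0r (b - a)); apply: cvgMl; exact: cvg_exp_coeff.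
Qed.

Lemma neglog_mean_le (g : R -> R) (k : nat) (c a b : R) :
  measurable_fun setT g -> 0 < c -> a < b -> c * (b - a) <= 1 ->
  (forall t, a < t <= b -> c * (t - a) <= g t) ->
  (neglog_mean g k a b <= (log_primitive c a k b)%:E)%E.
Proof.
move=> mg c0 ab cab cg; rewrite -integral_log_model//.
have mE D : measurable_fun D (fun t => (exp_coeff (neglog g t) k)%:E).
  by apply/measurable_EFinP; exact: measurable_exp_coeff_neglog.
rewrite /neglog_mean -integral_itv_obnd_cbnd//; apply: ge0_le_integral => //.
- by move=> t _; rewrite lee_fin exp_coeff_neglog_ge0.
- exact: mE.
- by apply/measurable_EFinP; exact: measurable_exp_coeff_ln.
- move=> t /=; rewrite in_itv/= => tab; have /andP[at0 tb] := tab.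
  have ct0 : 0 < c * (t - a) by rewrite mulr_gt0// subr_gt0.
  rewrite lee_fin ler_exp_coeff ?neglog_ge0// /neglog ge_max; apply/andP; split.
    rewrite oppr_ge0 ln_le0//; apply: le_trans cab.
    by rewrite ler_wpM2l ?(ltW c0)//; lra.
  by rewrite lerN2 ler_ln ?posrE ?cg//; apply: lt_le_trans ct0 _; exact: cg.
Qed.

(** Positivity of [g] is required for the comparison of logarithms: at a zero of [g] the convention
    [ln 0 = 0] would break it. *)
Lemma neglog_mean_ge (g : R -> R) (k : nat) (c a b : R) :
  measurable_fun setT g -> 0 < c -> a < b -> c * (b - a) <= 1 ->
  (forall t, a < t <= b -> 0 < g t <= c * (t - a)) ->
  ((log_primitive c a k b)%:E <= neglog_mean g k a b)%E.
Proof.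
move=> mg c0 ab cab cg; rewrite -integral_log_model//.
have mE D : measurable_fun D (fun t => (exp_coeff (neglog g t) k)%:E).
  by apply/measurable_EFinP; exact: measurable_exp_coeff_neglog.
rewrite /neglog_mean -[leRHS]integral_itv_obnd_cbnd//.
have L0 t : a < t <= b -> 0 <= - ln (c * (t - a)).
  move=> tab; rewrite oppr_ge0 ln_le0//; apply: le_trans cab.
  by rewrite ler_wpM2l ?(ltW c0)//; lra.
apply: ge0_le_integral => //.
- move=> t /=; rewrite in_itv/= => tab; rewrite lee_fin.
  exact/exp_coeff_ge0/L0.
- by apply/measurable_EFinP; exact: measurable_exp_coeff_ln.
- exact: mE.
- move=> t /=; rewrite in_itv/= => tab; have /andP[at0 tb] := tab.
  have /andP[gt0 gle] := cg _ tab.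
  rewrite lee_fin ler_exp_coeff ?L0// /neglog le_max; apply/orP; right.
  by rewrite lerN2 ler_ln ?posrE// mulr_gt0// subr_gt0.
Qed.

(** Testing against real numbers on either side treats finite and infinite limits alike; for
    [l = +oo] the upper condition is vacuous. *)
Lemma cvge_sandwich (u : nat -> \bar R) (l : \bar R) :
  (forall x : R, (x%:E < l)%E -> \forall k \near \oo, (x%:E <= u k)%E) ->
  (forall x : R, (l < x%:E)%E -> \forall k \near \oo, (u k <= x%:E)%E) ->
  u @ \oo --> l.
Proof.
case: l => [l| |] lo up; last 2 first.
- by apply/cvgeyPge => A; apply: lo; rewrite ltry.
- by apply/cvgeNyPle => A; apply: up; rewrite ltNyr.
have ufin : \forall k \near \oo, u k \is a fin_num.
  have h1 : \forall k \near \oo, ((l - 1)%:E <= u k)%E by apply: lo; rewrite lte_fin; lra.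
  have h2 : \forall k \near \oo, (u k <= (l + 1)%:E)%E by apply: up; rewrite lte_fin; lra.
  near=> k; rewrite fin_numElt; apply/andP; split.
    by apply: lt_le_trans (near h1 k _); rewrite ?ltNyr//; near: k.
  by apply: le_lt_trans (near h2 k _) _; rewrite ?ltry//; near: k.
apply/fine_cvgP; split => //; apply/cvgrPdist_le => e e0.
have h1 : \forall k \near \oo, ((l - e)%:E <= u k)%E by apply: lo; rewrite lte_fin; lra.
have h2 : \forall k \near \oo, (u k <= (l + e)%:E)%E by apply: up; rewrite lte_fin; lra.
near=> k => /=.
have uk : u k \is a fin_num by near: k.
have : ((l - e)%:E <= u k)%E by near: k.
have : (u k <= (l + e)%:E)%E by near: k.
move: uk; case: (u k) => //= r _; rewrite !lee_fin ler_distl => ? ?; lra.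
Unshelve. all: by end_near. Qed.

Lemma continuous_right_interval (h : R -> R) (a b C : R) (P : set R) :
  {for a, continuous h} -> a < b -> 0 < C -> nbhs (h a) P ->
  exists2 b', a < b' <= b & C * (b' - a) <= 1 /\ (forall t, a <= t <= b' -> P (h t)).
Proof.
move=> ch ab C0 /ch /nbhs_ballP[d /= d0 dP].
(* The three bounds keep [h] inside [P], the interval inside [[a, b]], and the model logarithm
   nonpositive. *)
pose e := Num.min (d / 2) (Num.min (b - a) C^-1).
have e0 : 0 < e by rewrite !lt_min divr_gt0// subr_gt0 ab invr_gt0.
exists (a + e).
  rewrite ltrDl e0/= -lerBrDl.
  by rewrite !ge_min lexx orbT.
split.
  rewrite addrAC subrr add0r -ler_pdivlMl// mulr1.
  by rewrite !ge_min lexx !orbT.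
move=> t /andP[at0 tb]; apply: dP; rewrite /ball/= ltr_norml.
have : e <= d / 2 by rewrite ge_min lexx.
by move=> ?; apply/andP; split; lra.
Qed.

(** Near [a] the function [g] is trapped between linear functions with slopes arbitrarily close to
    [h a], and a slope [c] contributes [1 / c] in the limit. *)
Lemma neglog_mean_right_cvg (g h : R -> R) (a b : R) :
  continuous g -> a < b -> (forall t, a < t <= b -> 0 < g t) ->
  {for a, continuous h} -> 0 <= h a ->
  (forall t, g t = `|t - a| * h t) ->
  neglog_mean g k a b @[k --> \oo] -->
    (if h a == 0%R then +oo else (h a)^-1%:E)%E.
Proof.
move=> cg ab g0 ch ha0 gE.
have mg : measurable_fun setT g by exact: continuous_measurable_fun.
apply: cvge_sandwich => x.
  move=> xh; have [x0|x0] := leP x 0.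
    apply: nearW => k; apply: le_trans (neglog_mean_ge0 _ _ _ _).
    by rewrite lee_fin.
  have hx : h a < x^-1.
    move: xh; case: ifPn => [/eqP ->|hn0]; first by rewrite invr_gt0.
    by rewrite lte_fin => xh; rewrite -[h a]invrK ltf_pV2// posrE invr_gt0 lt_def hn0.
  (* A slope strictly between [h a] and [1 / x]: it dominates [h] near [a], and its limit [1 / c]
     still exceeds [x]. *)
  pose c := (h a + x^-1) / 2.
  have hc : h a < c by rewrite /c; lra.
  have cx : c < x^-1 by rewrite /c; lra.
  have c0 : 0 < c by apply: le_lt_trans hc.
  have [b' /andP[ab' b'b] [cb hle]] :=
    continuous_right_interval ch ab c0 (lt_nbhsl hc).
  have xc : x < c^-1 by rewrite -[x]invrK ltf_pV2 ?posrE ?invr_gt0.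
  near=> k.
  have lp : x <= log_primitive c a k b'.
    by near: k; exact: (cvgr_ge _ (log_primitive_cvg c0 ab') _ xc).
  rewrite (neglog_mean_cat k mg (ltW ab') b'b).
  apply: (@le_trans _ _ (neglog_mean g k a b')); last first.
    by rewrite leeDl// neglog_mean_ge0.
  apply: (@le_trans _ _ (log_primitive c a k b')%:E); first by rewrite lee_fin.
  apply: neglog_mean_ge => // t /andP[at0 tb'].
  rewrite g0 ?at0 ?(le_trans tb')//= gE gtr0_norm ?subr_gt0// mulrC.
  by rewrite ler_wpM2r ?subr_ge0 ?(ltW at0)//; apply/ltW/hle; rewrite tb' ltW.
(* Upper bound: no real [x] lies above [+oo], so only [h a > 0] remains. *)
case: ifPn => // hn0; rewrite lte_fin => hx.
have {hn0}ha : 0 < h a by rewrite lt_def hn0.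
have x0 : 0 < x by apply: lt_trans hx; rewrite invr_gt0.
have xh : x^-1 < h a by rewrite -[h a]invrK ltf_pV2// posrE ?invr_gt0.
pose c := (h a + x^-1) / 2.
have hc : c < h a by rewrite /c; lra.
have cx : x^-1 < c by rewrite /c; lra.
have c0 : 0 < c by apply: lt_trans cx; rewrite invr_gt0.
have [b' /andP[ab' b'b] [cb hge]] :=
  continuous_right_interval ch ab c0 (lt_nbhsr hc).
have xc : c^-1 < x by rewrite -[x]invrK ltf_pV2 ?posrE ?invr_gt0.
(* For the upper bound the remainder [[b', b]] cannot just be dropped; [g] is positive there, so it
   vanishes in the limit. *)
have A0 : neglog_mean g k b' b @[k --> \oo] --> 0%E.
  apply: neglog_mean_pos_cvg0 => // t /andP[b't tb].
  by rewrite g0// tb (lt_le_trans ab').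
have sum_cvg : ((log_primitive c a k b')%:E + neglog_mean g k b' b)%E
    @[k --> \oo] --> (c^-1%:E + 0)%E.
  apply: cvgeD => //; apply: cvg_EFin; first exact: nearW.
  exact: log_primitive_cvg.
rewrite adde0 in sum_cvg.
have sum_lt : \forall k \near \oo,
    ((log_primitive c a k b')%:E + neglog_mean g k b' b < x%:E)%E.
  apply: (sum_cvg [set y | (y < x%:E)%E]).
  apply: open_nbhs_nbhs; split; first exact: open_ereal_lt_ereal.
  by rewrite /= lte_fin.
near=> k.
rewrite (neglog_mean_cat k mg (ltW ab') b'b).
apply: (@le_trans _ _ ((log_primitive c a k b')%:E + neglog_mean g k b' b)%E).
  rewrite leeD2r//; apply: neglog_mean_le => // t /andP[at0 tb'].
  rewrite gE gtr0_norm ?subr_gt0// mulrC.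
  by rewrite ler_wpM2l ?subr_ge0 ?(ltW at0)//; apply/ltW/hge; rewrite tb' ltW.
by apply: ltW; near: k.
Unshelve. all: by end_near. Qed.

(* [w] is the contribution of one side of [x] to the limit of [neglog_mean].  In
   the singular case [h x] is the one-sided slope of [g], in Caratheodory's form. *)
Definition neglog_weight (g : R -> R) (x : R) (w : \bar R) : Prop :=
  (0 < g x /\ w = 0%E) \/
  exists h : R -> R, [/\ {for x, continuous h}, 0 <= h x,
    forall t, g t = `|t - x| * h t &
    w = (if h x == 0%R then +oo else (h x)^-1%:E)%E].

Lemma neglog_weight_ge0 (g : R -> R) (x : R) (w : \bar R) :
  neglog_weight g x w -> (0 <= w)%E.
Proof.
case=> [[_ ->//]|[h [_ h0 _ ->]]]; case: ifPn => // _.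
by rewrite lee_fin invr_ge0.
Qed.

Lemma neglog_weight_opp (g : R -> R) (x : R) (w : \bar R) :
  neglog_weight g x w -> neglog_weight (g \o -%R) (- x) w.
Proof.
case=> [[gx ->]|[h [ch h0 gE ->]]]; [left; by rewrite /= opprK|right].
exists (h \o -%R); rewrite /= opprK; split => //.
  apply: continuous_comp; first exact: opp_continuous.
  by rewrite opprK.
by move=> t; rewrite gE -opprD normrN.
Qed.

Lemma neglog_mean_weight_right (g : R -> R) (a b : R) (w : \bar R) :
  continuous g -> a < b -> (forall t, a < t <= b -> 0 < g t) ->
  neglog_weight g a w ->
  neglog_mean g k a b @[k --> \oo] --> w.
Proof.
move=> cg ab g0 [[ga ->]|[h [ch h0 gE ->]]].
  apply: neglog_mean_pos_cvg0 => //; first exact: ltW.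
  move=> t /andP[]; rewrite le_eqVlt => /predU1P[<-//|at0 tb].
  by rewrite g0// at0.
exact: neglog_mean_right_cvg.
Qed.

Lemma neglog_mean_weight_left (g : R -> R) (a b : R) (w : \bar R) :
  continuous g -> a < b -> (forall t, a <= t < b -> 0 < g t) ->
  neglog_weight g b w ->
  neglog_mean g k a b @[k --> \oo] --> w.
Proof.
move=> cg ab g0 gw.
have mg : measurable_fun setT g by exact: continuous_measurable_fun.
rewrite (_ : (fun k => _) = (fun k => neglog_mean (g \o -%R) k (- b) (- a))); last first.
  by apply/funext => k; rewrite neglog_mean_opp.
apply: neglog_mean_weight_right (neglog_weight_opp gw).
- by move=> t; apply: continuous_comp; [exact: opp_continuous|exact: cg].
- by rewrite ltrN2.
- by move=> t tab /=; apply: g0; lra.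
Qed.

(** Cutting at the midpoint leaves at most one zero in each half. Both weights are nonnegative, so
    their sum is defined even when infinite. *)
Lemma neglog_mean_weight (g : R -> R) (a b : R) (wa wb : \bar R) :
  continuous g -> a < b -> (forall t, a < t < b -> 0 < g t) ->
  neglog_weight g a wa -> neglog_weight g b wb ->
  neglog_mean g k a b @[k --> \oo] --> (wa + wb)%E.
Proof.
move=> cg ab g0 gwa gwb.
have mg : measurable_fun setT g by exact: continuous_measurable_fun.
pose m := (a + b) / 2.
have am : a < m by rewrite /m; lra.
have mb : m < b by rewrite /m; lra.
rewrite (_ : (fun k => _) = (fun k => neglog_mean g k a m + neglog_mean g k m b)%E); last first.
  by apply/funext => k; rewrite -neglog_mean_cat// ltW.
apply: cvgeD.
- by rewrite ge0_adde_def// inE ?(neglog_weight_ge0 gwa) ?(neglog_weight_ge0 gwb).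
- apply: neglog_mean_weight_right => // t /andP[? ?]; apply: g0.
  by apply/andP; split => //; exact: le_lt_trans mb.
- apply: neglog_mean_weight_left => // t /andP[? ?]; apply: g0.
  by apply/andP; split => //; exact: lt_le_trans am _.
Qed.

(** The points of [l] cut [[a, b]] into intervals with positive [g] inside. An interior point bounds
    two of them and counts twice, an endpoint once. *)
Lemma neglog_mean_path (g : R -> R) (w : R -> \bar R) (b : R) (l : seq R) (a : R) :
  continuous g -> (forall x, neglog_weight g x (w x)) ->
  path <%R a (rcons l b) ->
  (forall t, a < t < b -> t \notin l -> 0 < g t) ->
  neglog_mean g k a b @[k --> \oo] -->
    (w a + (\sum_(x <- l) (w x + w x) + w b))%E.
Proof.
move=> cg gw; have w0 x : (0 <= w x)%E := neglog_weight_ge0 (gw x).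
have mg : measurable_fun setT g by exact: continuous_measurable_fun.
elim: l a => [|x l IH] a /=.
  rewrite andbT big_nil add0e => ab g0.
  by apply: neglog_mean_weight => // t tab; exact: g0.
move=> /andP[ax xlb] g0.
(* All later points lie beyond [x], so no point of the list lies in []a, x[]. *)
have xl : all (fun y => x < y) (rcons l b).
  by apply: order_path_min xlb; exact: lt_trans.
have xb : x < b by have := allP xl b; apply; rewrite mem_rcons inE eqxx.
rewrite (_ : (fun k => _) = (fun k => neglog_mean g k a x + neglog_mean g k x b)%E); last first.
  by apply/funext => k; rewrite -neglog_mean_cat// ltW.
rewrite big_cons -!addeA (addeA (w a)); apply: cvgeD.
- by rewrite ge0_adde_def// inE ?adde_ge0// sume_ge0// => y _; rewrite adde_ge0.
- apply: neglog_mean_weight => // t /andP[at0 tx]; apply: g0.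
    by rewrite at0 (lt_trans tx).
  rewrite inE negb_or lt_eqF//=; apply/negP => tl.
  have := allP xl t; rewrite mem_rcons inE tl orbT => /(_ isT).
  by rewrite ltNge ltW.
- apply: IH => // t /andP[xt tb] tl; apply: g0.
    by rewrite tb (lt_trans ax).
  by rewrite inE negb_or tl gt_eqF.
Qed.

End neglog_mean.

(** * Laurent polynomials on the unit circle *)

Section unit_circle.
Context {R : realType}.
Implicit Types (z w : R[i]) (p : {poly R[i]}) (t x : R).

Lemma cmod_normc z : cmod z = ComplexField.Normc.normc z.
Proof. by case: z. Qed.

Lemma cmodM z w : cmod (z * w) = cmod z * cmod w.
Proof. by rewrite !cmod_normc ComplexField.Normc.normcM. Qed.

Lemma cmodV z : cmod z^-1 = (cmod z)^-1.
Proof. by rewrite !cmod_normc ComplexField.Normc.normcV. Qed.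

Lemma cmodX z n : cmod (z ^+ n) = cmod z ^+ n.
Proof.
elim: n => [|n IH]; last by rewrite !exprS cmodM IH.
by rewrite !expr0 cmod_normc ComplexField.Normc.normc1.
Qed.

Lemma cmod_ge0 z : 0 <= cmod z.
Proof. exact: sqrtr_ge0. Qed.

Lemma cmod_eq0 z : (cmod z == 0) = (z == 0).
Proof.
apply/eqP/eqP => [|->]; rewrite cmod_normc.
  exact: ComplexField.Normc.eq0_normc.
exact: ComplexField.Normc.normc0.
Qed.

Lemma cmod_expi2pi t : cmod (expi2pi t) = 1.
Proof. by rewrite /cmod /= cos2Dsin2 sqrtr1. Qed.

Lemma expi2pi_neq0 t : expi2pi t != 0.
Proof. by rewrite -cmod_eq0 cmod_expi2pi oner_eq0. Qed.

Lemma cmod_chord t x : cmod (expi2pi t - expi2pi x) = 2 * `|sin (pi * (t - x))|.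
Proof.
rewrite /cmod /=.
rewrite [X in Num.sqrt X](_ : _ = (2 * sin (pi * (t - x))) ^+ 2).
  by rewrite sqrtr_sqr normrM ger0_norm.
(* The squared chord is [2 - 2 cos (2 pi (t - x))]; the half-angle formula turns it into a
   square. *)
have E : cos (2 * pi * t - 2 * pi * x) = 1 - 2 * sin (pi * (t - x)) ^+ 2.
  rewrite (_ : _ - _ = (pi * (t - x)) *+ 2); last by rewrite -mulr_natl; ring.
  by rewrite cos_mulr2n cos2sin2 -mulr_natl; ring.
have h1 := cos2Dsin2 (2 * pi * t); have h2 := cos2Dsin2 (2 * pi * x).
rewrite cosB in E; nra.
Qed.

(** For [u < v] in [[0, 1[] the angle [pi * (v - u)] lies strictly between 0 and [pi], so its sine,
    hence the chord, is nonzero. *)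
Lemma expi2pi_inj t x : 0 <= t < 1 -> 0 <= x < 1 -> expi2pi t = expi2pi x -> t = x.
Proof.
suff H (u v : R) : 0 <= u < 1 -> 0 <= v < 1 -> expi2pi u = expi2pi v -> ~ u < v.
  move=> t1 x1 tx; apply/eqP; rewrite eq_le !leNgt.
  by apply/andP; split; apply/negP; exact: H.
move=> u1 v1 uv ltuv; have := cmod_chord v u.
rewrite uv subrr => /esym/eqP.
rewrite cmod_normc ComplexField.Normc.normc0 mulf_eq0 pnatr_eq0/= normr_eq0.
apply/negP; rewrite gt_eqF// sin_gt0_pi// mulr_gt0 ?pi_gt0 ?subr_gt0//=.
by rewrite -[ltRHS]mulr1 ltr_pM2l ?pi_gt0//; lra.
Qed.

Lemma expi2pi_surj z : cmod z = 1 -> exists2 t, 0 <= t < 1 & expi2pi t = z.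
Proof.
case: z => a b; rewrite /cmod/= => ab1.
have {}ab1 : a ^+ 2 + b ^+ 2 = 1.
  by rewrite -[LHS]sqr_sqrtr ?ab1 ?expr1n// addr_ge0// sqr_ge0.
have a1 : -1 <= a <= 1.
  by rewrite -ler_norml -(@ler_sqr R) ?nnegrE// expr1n real_normK ?num_real//; nra.
have cosa : cos (acos a) = a by rewrite acosK// in_itv.
have sina : sin (acos a) = `|b|.
  by rewrite sin_acos// (_ : 1 - a ^+ 2 = b ^+ 2) ?sqrtr_sqr//; lra.
have pi0 := pi_gt0 R.
have [b0|b0] := leP 0 b.
  exists (acos a / (2 * pi)).
    rewrite divr_ge0 ?acos_ge0 ?mulr_ge0 ?pi_ge0//= ltr_pdivrMr ?mulr_gt0//.
    by rewrite mul1r (le_lt_trans (acos_lepi a1))//; lra.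
  rewrite /expi2pi mulrC mulfVK ?mulf_neq0 ?gt_eqF//.
  by rewrite cosa sina ger0_norm.
(* On the lower half circle the angle is reflected. Here [b < 0] forces [acos a > 0], which keeps
   the parameter strictly below 1. *)
have alt1 : a < 1 by nra.
exists (1 - acos a / (2 * pi)).
  rewrite subr_ge0 ltrBlDl ltrDr divr_gt0 ?mulr_gt0 ?acos_gt0 ?alt1 ?andbT; try lra.
  by rewrite ler_pdivrMr ?mulr_gt0// mul1r (le_trans (acos_lepi a1))//; lra.
rewrite /expi2pi mulrBr mulr1 [_ * (acos a / _)]mulrC mulfVK ?mulf_neq0 ?gt_eqF//.
rewrite mulr_natl cosB sinB cos2pi sin2pi cosa sina ltr0_norm//.
by rewrite !mul1r !mul0r addr0 add0r opprK.
Qed.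

(** Both parts are proved together because each Horner step mixes them. *)
Lemma continuous_Re_Im_horner p :
  continuous (fun t => complex.Re p.[expi2pi t]) /\
  continuous (fun t => complex.Im p.[expi2pi t]).
Proof.
have c2 : continuous (fun t : R => 2 * pi * t) by exact: mulrl_continuous.
have cc : continuous (fun t : R => cos (2 * pi * t)).
  by move=> t; apply: (continuous_comp (c2 t)); exact: continuous_cos.
have cs : continuous (fun t : R => sin (2 * pi * t)).
  by move=> t; apply: (continuous_comp (c2 t)); exact: continuous_sin.
elim/poly_ind: p => [|p c [IHr IHi]].
  by split=> t; under eq_fun do rewrite horner0; exact: cvg_cst.
split.
  rewrite (_ : (fun _ => _) = (fun t => complex.Re p.[expi2pi t] * cos (2 * pi * t)
     - complex.Im p.[expi2pi t] * sin (2 * pi * t) + complex.Re c)); last first.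
    apply/funext => u; rewrite hornerMXaddC /expi2pi.
    by case: (p.[_]) => ? ?; case: c.
  move=> t; apply: cvgD; last exact: cvg_cst.
  by apply: cvgB; apply: cvgM; [exact: IHr|exact: cc|exact: IHi|exact: cs].
rewrite (_ : (fun _ => _) = (fun t => complex.Re p.[expi2pi t] * sin (2 * pi * t)
   + complex.Im p.[expi2pi t] * cos (2 * pi * t) + complex.Im c)); last first.
  apply/funext => u; rewrite hornerMXaddC /expi2pi.
  by case: (p.[_]) => ? ?; case: c.
move=> t; apply: cvgD; last exact: cvg_cst.
by apply: cvgD; apply: cvgM; [exact: IHr|exact: cs|exact: IHi|exact: cc].
Qed.

Lemma continuous_cmod_horner p : continuous (fun t => cmod p.[expi2pi t]).
Proof.
have [cr ci] := continuous_Re_Im_horner p => t; rewrite /cmod.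
apply: (@continuous_comp _ _ _ (fun t => complex.Re p.[expi2pi t] ^+ 2 +
  complex.Im p.[expi2pi t] ^+ 2) Num.sqrt); last exact: sqrt_continuous.
by apply: cvgD; apply: cvgM; (exact: cr || exact: ci).
Qed.

Lemma cmod_leval (P : laurent R) t :
  cmod (leval P (expi2pi t)) = cmod (lpoly P).[expi2pi t].
Proof. by rewrite /leval cmodM cmodV cmodX cmod_expi2pi expr1n invr1 mulr1. Qed.

Lemma continuous_cmod_leval (P : laurent R) :
  continuous (fun t => cmod (leval P (expi2pi t))).
Proof.
rewrite (_ : (fun _ => _) = fun t => cmod (lpoly P).[expi2pi t]).
  exact: continuous_cmod_horner.
by apply/funext => t; rewrite cmod_leval.
Qed.

(** Writing [Q = S * (X - z)], the modulus is [|S|] times the chord [2 |sin (pi (t - x))|]. Dividing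
    the sine by its argument leaves a continuous factor. *)
Lemma cmod_leval_factor (P : laurent R) x : leval P (expi2pi x) = 0 ->
  exists h : R -> R, [/\ {for x, continuous h},
    h x = 2 * pi * cmod (lderiv P (expi2pi x)) &
    forall t, cmod (leval P (expi2pi t)) = `|t - x| * h t].
Proof.
set z := expi2pi x => Pz0.
have Qz0 : (lpoly P).[z] = 0.
  by apply/eqP; rewrite -cmod_eq0 -cmod_leval Pz0 cmod_eq0.
have /factor_theorem[S QE] : root (lpoly P) z by apply/rootP.
(* At a root on the circle, [P'(z)] is [S(z)] up to a factor of modulus 1. *)
have dE : cmod (lderiv P z) = cmod S.[z].
  rewrite /lderiv Qz0 mulr0 mul0r subr0 cmodM cmodV cmodX cmod_expi2pi expr1n.
  rewrite invr1 mulr1 QE derivM derivXsubC mulr1 !hornerE.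
  by rewrite subrr mulr0 add0r.
(* Here [sin y = u y * y] with [u] continuous at 0 and [u 0 = cos 0 = 1]. *)
have /is_derive1_caratheodory[u [uE cu u0]] := is_derive_sin (0 : R).
have cpi : {for x, continuous (fun t : R => pi * (t - x))}.
  by apply: cvgMr; apply: cvgB => //; exact: cvg_cst.
exists (fun t => 2 * pi * `|u (pi * (t - x))| * cmod S.[expi2pi t]); split.
- apply: cvgM; last exact: continuous_cmod_horner.
  apply: cvgMr; apply: cvg_norm.
  apply: (continuous_comp cpi); by rewrite subrr mulr0.
- by rewrite subrr mulr0 u0 cos0 normr1 mulr1 dE.
- move=> t; rewrite cmod_leval QE hornerM cmodM hornerXsubC cmod_chord.
  have := uE (pi * (t - x)); rewrite sin0 !subr0 => ->.
  by rewrite !normrM (ger0_norm (pi_ge0 R)); ring.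
Qed.

End unit_circle.

(** * Higher Mahler measures *)

Section higher_mahler_limit.
Context {R : realType}.
Local Notation mu := (@lebesgue_measure R).
Implicit Types (P : laurent R) (g : R -> R).

Definition poslog g (t : R) : R := Num.max 0 (ln (g t)).

Lemma poslog_ge0 g t : 0 <= poslog g t.
Proof. by rewrite le_max lexx. Qed.

Lemma measurable_exp_coeff_poslog g (k : nat) (D : set R) :
  measurable_fun setT g -> measurable_fun D (fun t => exp_coeff (poslog g t) k).
Proof.
move=> mg; apply: measurable_funTS; rewrite /exp_coeff/=.
apply: measurable_funM => //; apply: measurable_funX.
apply: measurable_maxr => //.
exact: (measurableT_comp (@measurable_ln R)).
Qed.

(** At most one of the two parts is nonzero at [t], so the power has no mixed terms; [0 < k]
    excludes [0 ^+ 0 = 1], which would count both. *)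
Lemma ln_expE g (k : nat) t : (0 < k)%N ->
  ln (g t) ^+ k = k`!%:R * exp_coeff (poslog g t) k
    + (-1) ^+ k * (k`!%:R * exp_coeff (neglog g t) k).
Proof.
move=> k0; have kf : k`!%:R != 0 :> R by rewrite pnatr_eq0 -lt0n fact_gt0.
rewrite /exp_coeff/= ![k`!%:R * _]mulrC !mulfVK// /poslog /neglog.
have [f0|f0] := leP 0 (ln (g t)).
  rewrite (max_idPl _) ?oppr_le0//.
  by rewrite expr0n eqn0Ngt k0/= mulr0 addr0.
rewrite (max_idPr _) ?oppr_ge0 ?ltW//.
by rewrite expr0n eqn0Ngt k0/= add0r -exprMn mulN1r opprK.
Qed.

Definition poslog_mean g (k : nat) : \bar R :=
  (\int[mu]_(t in `[0%R, 1%R]) (exp_coeff (poslog g t) k)%:E)%E.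

Lemma poslog_mean_ge0 g k : (0 <= poslog_mean g k)%E.
Proof.
by apply: integral_ge0 => t _; rewrite lee_fin exp_coeff_ge0// poslog_ge0.
Qed.

Lemma poslog_mean_bound g : continuous g -> exists M : R,
  forall k, (poslog_mean g k <= (exp_coeff M k)%:E)%E.
Proof.
move=> cg; have mg : measurable_fun setT g by exact: continuous_measurable_fun.
have [m _ gm] := EVT_max (@ler01 R) (continuous_subspaceT cg).
exists (poslog g m) => k.
rewrite [leRHS](_ : _ = \int[mu]_(t in `[0%R, 1%R]) (exp_coeff (poslog g m) k)%:E)%E; last first.
  by rewrite integral_cst//= lebesgue_measure_itv/= lte_fin ltr01 sube0 mule1.
apply: ge0_le_integral => //.
- by move=> t _; rewrite lee_fin exp_coeff_ge0// poslog_ge0.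
- by apply/measurable_EFinP; exact: measurable_exp_coeff_poslog.
- move=> t /= t01; rewrite lee_fin ler_exp_coeff ?poslog_ge0//.
  rewrite /poslog ge_max le_max lexx/= le_max.
  have [g0|g0] := leP (g t) 0; first by rewrite (@ln0 _ (g t))// lexx.
  rewrite ler_ln ?posrE ?gm ?orbT//.
  by apply: lt_le_trans g0 _; exact: gm.
Qed.

(** For odd [k] the two terms are exactly the positive and negative parts of the integrand, since
    they never overlap; finiteness of the first integral makes the difference meaningful. For even
    [k] both terms are nonnegative and integrals add. *)
Lemma integral_ln_exp g (k : nat) : measurable_fun setT g -> (0 < k)%N ->
  poslog_mean g k \is a fin_num ->
  (\int[mu]_(t in `[0%R, 1%R]) (ln (g t) ^+ k)%:E =
   (k`!%:R)%:E * (if odd k then poslog_mean g k - neglog_mean g k 0 1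
    else poslog_mean g k + neglog_mean g k 0 1))%E.
Proof.
move=> mg k0 pfin.
have mp D : measurable_fun D (fun t => (exp_coeff (poslog g t) k)%:E).
  by apply/measurable_EFinP; exact: measurable_exp_coeff_poslog.
have mn D : measurable_fun D (fun t => (exp_coeff (neglog g t) k)%:E).
  by apply/measurable_EFinP; exact: measurable_exp_coeff_neglog.
have p0 t : 0 <= exp_coeff (poslog g t) k by rewrite exp_coeff_ge0// poslog_ge0.
have n0 t : 0 <= exp_coeff (neglog g t) k by exact: exp_coeff_neglog_ge0.
have zp t : exp_coeff (poslog g t) k = 0 \/ exp_coeff (neglog g t) k = 0.
  rewrite /exp_coeff/= /poslog /neglog; have [f0|f0] := leP 0 (ln (g t)).
    right; rewrite (max_idPl _) ?oppr_le0//.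
    by rewrite expr0n eqn0Ngt k0/= mul0r.
  by left; rewrite expr0n eqn0Ngt k0/= mul0r.
under eq_integral do rewrite ln_expE//.
case: ifPn => ok.
  rewrite -signr_odd ok expr1 integralE muleBr//; last first.
    by rewrite fin_num_adde_defr.
  congr (_ - _)%E.
    rewrite /poslog_mean -ge0_integralZl//; [|exact: mp|by move=> t _; rewrite lee_fin].
    apply: eq_integral => t _; rewrite funeposE mulN1r/= -EFinM -EFin_max.
    congr EFin; have [->|->] := zp t; rewrite ?mulr0 ?add0r ?oppr0 ?addr0.
      by rewrite (max_idPr _)// oppr_le0 mulr_ge0.
    by rewrite (max_idPl _)// mulr_ge0.
  rewrite /neglog_mean -ge0_integralZl//; [|exact: mn|by move=> t _; rewrite lee_fin].
  apply: eq_integral => t _; rewrite funenegE mulN1r/= -EFinM -EFin_max.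
  congr EFin; have [->|->] := zp t; rewrite ?mulr0 ?add0r ?oppr0 ?addr0 ?opprK.
    by rewrite (max_idPl _)// mulr_ge0.
  by rewrite (max_idPr _)// oppr_le0 mulr_ge0.
rewrite -signr_odd (negbTE ok) expr0.
rewrite ge0_muleDr ?poslog_mean_ge0 ?neglog_mean_ge0//.
rewrite /poslog_mean -ge0_integralZl//; [|exact: mp|by move=> t _; rewrite lee_fin].
rewrite /neglog_mean -ge0_integralZl//; [|exact: mn|by move=> t _; rewrite lee_fin].
rewrite -ge0_integralD//.
- by apply: eq_integral => t _; rewrite mul1r.
- by move=> t _; rewrite mule_ge0// lee_fin.
- by apply: measurable_funeM; exact: mp.
- by move=> t _; rewrite mule_ge0// lee_fin.
- by apply: measurable_funeM; exact: mn.
Qed.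

(** The parity [s] only fixes the relative sign of the finite term [b], which shifts the absolute
    value by at most [b]; [a] may be [+oo]. *)
Lemma abse_sandwich (a b : \bar R) (s : bool) :
  (0 <= a -> 0 <= b -> b \is a fin_num ->
   a - b <= `|if s then b - a else b + a| <= a + b)%E.
Proof.
case: b => // b a0; rewrite lee_fin => b0 _; case: a a0 => [a| |]//; last first.
  by move=> _; case: s.
rewrite lee_fin => a0; case: s; rewrite -?EFinN -!EFinD abse_EFin !lee_fin.
  by rewrite distrC ler_norm/= ler_distl; apply/andP; split; lra.
by rewrite ger0_norm ?addr_ge0// [b + a]addrC lexx andbT lerD2l; lra.
Qed.

Lemma higher_mahler_sandwich P (k : nat) :
  let g t := cmod (leval P (expi2pi t)) in
  (0 < k)%N -> poslog_mean g k \is a fin_num ->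
  (neglog_mean g k 0 1 - poslog_mean g k
     <= `|higher_mahler k P| * (k`!%:R^-1)%:E
     <= neglog_mean g k 0 1 + poslog_mean g k)%E.
Proof.
move=> g k0 pfin.
have mg : measurable_fun setT g.
  by apply: continuous_measurable_fun; exact: continuous_cmod_leval.
rewrite /higher_mahler (integral_ln_exp mg)// abseM muleC muleA.
rewrite abse_EFin ger0_norm// -EFinM mulVf ?mul1e; last first.
  by rewrite pnatr_eq0 -lt0n fact_gt0.
by apply: abse_sandwich => //; [exact: neglog_mean_ge0|exact: poslog_mean_ge0].
Qed.

Lemma cvg_higher_mahler P (l : \bar R) :
  neglog_mean (fun t => cmod (leval P (expi2pi t))) k 0 1 @[k --> \oo] --> l ->
  (`|higher_mahler k P| * (k`!%:R^-1)%:E)%E @[k --> \oo] --> l.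
Proof.
pose g t := cmod (leval P (expi2pi t)); move=> gl.
have [M gM] := poslog_mean_bound (@continuous_cmod_leval R P).
have p0 : poslog_mean g k @[k --> \oo] --> 0%E.
  apply: (@squeeze_cvge _ _ _ _ (cst 0%E) _ (fun k => (exp_coeff M k)%:E)).
  - by apply: nearW => k; rewrite poslog_mean_ge0/=; exact: gM.
  - exact: cvg_cst.
  - by apply: cvg_EFin; [exact: nearW|exact: cvg_exp_coeff].
have pfin k : poslog_mean g k \is a fin_num.
  rewrite ge0_fin_numE ?poslog_mean_ge0//.
  by apply: le_lt_trans (gM k) _; rewrite ltry.
apply: (@squeeze_cvge _ _ _ _
  (fun k => neglog_mean g k 0 1 - poslog_mean g k)%E _
  (fun k => neglog_mean g k 0 1 + poslog_mean g k)%E).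
- by near=> k; apply: higher_mahler_sandwich => //; near: k; exact: nbhs_infty_gt.
- by rewrite -[l]sube0; apply: cvgeB => //; rewrite fin_num_adde_defl.
- by rewrite -[l]adde0; apply: cvgeD => //; rewrite fin_num_adde_defl.
Unshelve. all: by end_near. Qed.

(** This is the contribution of one side of [x], hence the factor 2: both sides together give
    [1 / (pi |P'|)]. *)
Definition mahler_weight P (x : R) : \bar R :=
  if leval P (expi2pi x) != 0 then 0%E
  else if lderiv P (expi2pi x) == 0 then +oo%E
  else ((2 * pi * cmod (lderiv P (expi2pi x)))^-1)%:E.

Lemma neglog_weight_mahler P (x : R) :
  neglog_weight (fun t => cmod (leval P (expi2pi t))) x (mahler_weight P x).
Proof.
rewrite /mahler_weight; case: ifPn => [Px|]; last rewrite negbK => /eqP Px.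
  by left; split => //; rewrite lt_def cmod_eq0 Px cmod_ge0.
right; have [h [ch hx hE]] := cmod_leval_factor Px.
have tpi : 2 * pi != 0 :> R by rewrite mulf_neq0// gt_eqF ?pi_gt0.
exists h; split => //.
  by rewrite hx !mulr_ge0 ?pi_ge0 ?cmod_ge0.
by rewrite hx mulf_eq0 (negbTE tpi)/= cmod_eq0.
Qed.

(** All terms are nonnegative, so one infinite term makes the whole sum [+oo] and the case
    distinction can move inside. *)
Lemma mahler_rhs_sum P (s : seq R[i]) :
  mahler_rhs P s = (\sum_(z <- s) (if lderiv P z == 0%R then +oo
    else (pi^-1 * (cmod (lderiv P z))^-1)%:E))%E.
Proof.
rewrite /mahler_rhs; pose F z : \bar R := if lderiv P z == 0 then +oo%E
  else (pi^-1 * (cmod (lderiv P z))^-1)%:E.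
rewrite -[RHS]/(\sum_(z <- s) F z)%E.
have F0 z : (0 <= F z)%E.
  rewrite /F; case: ifPn => // _.
  by rewrite lee_fin mulr_ge0 ?invr_ge0 ?pi_ge0 ?cmod_ge0.
elim: s => [|z s IH] /=; first by rewrite !big_nil mulr0.
rewrite !big_cons -IH {1}/F; have [_|_] /= := eqVneq (lderiv P z) 0.
  rewrite addye// gt_eqF// (@lt_le_trans _ _ 0%E)// ?ltNy0//.
  by rewrite IH; exact: sume_ge0.
by case: ifPn => // _; rewrite -EFinD mulrDr.
Qed.

End higher_mahler_limit.

(** * Assembling the contributions of the roots on the unit circle *)

Theorem theorem1 (R : realType) (P : laurent R) (s : seq R[i]) :
  lnonzero P ->
  uniq s ->
  (forall z : R[i], z \in s = lroot P z && (cmod z == 1)) ->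
  ((fun k : nat => (`| higher_mahler k P | * ((k`!)%:R^-1)%:E)%E)
     @ \oo --> mahler_rhs P s)%classic.
Proof.
move=> _ us sE; apply: cvg_higher_mahler.
set g := fun t => cmod _.
(* The default 0 is taken only for [z] off the unit circle. *)
pose arg z : R := xget 0 [set t | 0 <= t < 1 /\ expi2pi t = z].
have argP z : z \in s -> 0 <= arg z < 1 /\ expi2pi (arg z) = z.
  rewrite sE => /andP[_ /eqP /expi2pi_surj[t t01 tz]].
  by apply: (@xgetPex _ 0 [set t | 0 <= t < 1 /\ expi2pi t = z]); exists t.
pose ts := [seq arg z | z <- s].
have uts : uniq ts.
  rewrite map_inj_in_uniq// => z w zs ws argzw.
  by rewrite -(argP z zs).2 -(argP w ws).2 argzw.
have ts01 t : t \in ts -> 0 <= t < 1.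
  by move=> /mapP[z zs ->]; have [] := argP z zs.
have rootts t : 0 <= t < 1 -> leval P (expi2pi t) = 0 -> t \in ts.
  move=> t01 Pt.
  have es : expi2pi t \in s by rewrite sE /lroot expi2pi_neq0 Pt cmod_expi2pi !eqxx.
  apply/mapP; exists (expi2pi t) => //.
  by have [a01 ae] := argP _ es; apply: expi2pi_inj.
have [w gw wE] : exists2 w, forall x, neglog_weight g x (w x) & w = mahler_weight P.
  by exists (mahler_weight P) => //; exact: neglog_weight_mahler.
have w10 : w 1 = w 0.
  have e10 : expi2pi 1 = expi2pi 0 :> R[i].
    by rewrite /expi2pi mulr1 mulr0 mulr_natl cos2pi sin2pi cos0 sin0.
  by rewrite wE /mahler_weight e10.
(* A root at [t = 0] also shows up at [t = 1]; each end contributes one side. *)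
pose l := sort <=%R (rem 0 ts).
have url : uniq (rem 0 ts) by exact: rem_uniq.
have memE t : (t \in l) = (t != 0) && (t \in ts).
  by rewrite mem_sort mem_rem_uniq// inE.
have lpath : path <%R 0 (rcons l 1).
  rewrite rcons_path path_min_sorted; last first.
    apply/allP => t; rewrite memE => /andP[t0 /ts01/andP[]].
    by rewrite le_eqVlt eq_sym (negbTE t0).
  rewrite sort_lt_sorted url/=.
  have := mem_last 0 l; rewrite inE => /predU1P[->//|].
  by rewrite memE => /andP[_ /ts01/andP[]].
have -> : mahler_rhs P s = (w 0%R + (\sum_(x <- l) (w x + w x) + w 1%R))%E.
  (* Each root contributes [1 / (2 pi |P'|)] from either side, which is its term on the right-hand
     side. *)
  transitivity (\sum_(x <- ts) (w x + w x))%E.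
    rewrite mahler_rhs_sum big_map big_seq [RHS]big_seq; apply: eq_bigr => z zs.
    have [a01 ae] := argP z zs; rewrite wE /mahler_weight ae.
    move: zs; rewrite sE => /andP[/andP[_ ->] _]/=; case: ifPn => // dz.
    have := pi_gt0 R; move: pi => c c0; rewrite -EFinD; congr EFin.
    by field; rewrite cmod_eq0 dz gt_eqF.
  rewrite w10 (addeC (\sum_(x <- l) _)%E) addeA.
  have -> : (\sum_(x <- l) (w x + w x) = \sum_(x <- rem 0%R ts) (w x + w x))%E.
    by apply: perm_big; rewrite perm_sort.
  have [t0|t0] := boolP (0 \in ts); first by rewrite (big_rem _ t0).
  (* If 1 is not a root of [P], the endpoints 0 and 1 have weight 0 and nothing was removed from
     [ts]. *)
  suff -> : w 0 = 0%E by rewrite !add0e rem_id.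
  rewrite wE /mahler_weight ifT//; apply: contra t0 => /eqP P0.
  by apply: rootts; rewrite ?lexx ?ltr01.
apply: neglog_mean_path => //; first exact: continuous_cmod_leval.
move=> t /andP[t0 t1]; rewrite memE gt_eqF//= => tts.
rewrite /g lt_def cmod_ge0 andbT cmod_eq0; apply: contra tts => /eqP.
by apply: rootts; rewrite t1 ltW.
Qed.
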